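(* Let $n$ be a positive integer. A UC-move is realized by a sequence of $V(n)$-moves and welded Reidemeister moves. Hence the $V(n)$-move is an unknotting operation for welded knots, i.e., every welded knot is $V(n)$-equivalent to the unknot.
   Context: A virtual link diagram is the image of an immersion of finitely many ordered, oriented circles in the plane whose double points are transverse and each is either a classical crossing (with over/under information) or a virtual crossing. Welded Reidemeister moves are: the classical Reidemeister moves R1–R3; the virtual moves VR1–VR3 (Reidemeister moves with all crossings virtual) and VR4 (a strand with only virtual crossings slides past a classical crossing); and the OC move (a strand passing over two other strands at two classical crossings, those two strands crossing each other at a virtual crossing, may be slid across that virtual crossing). A welded link (knot if one component) is an equivalence class of diagrams under welded Reidemeister moves. The UC move is the same as OC with ''over'' replaced by ''under''. The $V(n)$-move: inside a disk the diagram consists of two arcs oriented in the same direction; on one side the arcs twist around each other through $n$ consecutive classical crossings forming a two-strand twist (the $2$-braid $\sigma^n$, all crossings of the same sign); on the other side the arcs, with the same four endpoints, cross once at a single virtual crossing; the move replaces one side by the other. Two welded links are $V(n)$-equivalent if diagrams of them are related by $V(n)$-moves and welded Reidemeister moves. *)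

(* Defs.v *)
(* Welded links are encoded by Gauss diagrams. *)
From mathcomp Require Import all_boot.
From Stdlib Require Export Relations.
Set Implicit Arguments. Unset Strict Implicit. Unset Printing Implicit Defensive.

(* A letter of a Gauss word: (crossing label, is-over-endpoint, sign (true = +)).
   A diagram is a list of (cyclic) Gauss words, one per circle. *)
Definition letter := (nat * bool * bool)%type.
Definition gauss := seq (seq letter).
Definition lid (l : letter) : nat := l.1.1.
Definition lover (l : letter) : bool := l.1.2.
Definition lsign (l : letter) : bool := l.2.
Definition ids (D : gauss) : seq nat := map lid (flatten D).
Definition fresh (c : nat) (D : gauss) : bool := c \notin ids D.

Definition wf_gauss (D : gauss) : Prop :=
  forall c, c \in ids D ->
    [/\ count (fun l => (lid l == c) && lover l) (flatten D) = 1,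
        count (fun l => (lid l == c) && ~~ lover l) (flatten D) = 1 &
        forall l1 l2, l1 \in flatten D -> l2 \in flatten D ->
          lid l1 = c -> lid l2 = c -> lsign l1 = lsign l2].

Definition unknot : gauss := [:: [::]].

(* Two segments s1, s2 placed in a diagram: on one circle, or on two circles
   (other circles R; placement anywhere is reached by rotation/permutation). *)
Definition fill2 (sh : bool) (s1 s2 w1 w2 : seq letter) (R : gauss) : gauss :=
  if sh then (s1 ++ w1 ++ s2 ++ w2) :: R else (s1 ++ w1) :: (s2 ++ w2) :: R.

Definition fill3 (sh : nat) (s1 s2 s3 w1 w2 w3 : seq letter) (R : gauss) : gauss :=
  match sh with
  | 0 => (s1 ++ w1 ++ s2 ++ w2 ++ s3 ++ w3) :: R
  | 1 => (s1 ++ w1 ++ s3 ++ w2 ++ s2 ++ w3) :: R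
  | 2 => (s1 ++ w1 ++ s2 ++ w2) :: (s3 ++ w3) :: R
  | 3 => (s1 ++ w1 ++ s3 ++ w2) :: (s2 ++ w3) :: R
  | 4 => (s2 ++ w1 ++ s3 ++ w2) :: (s1 ++ w3) :: R
  | _ => (s1 ++ w1) :: (s2 ++ w2) :: (s3 ++ w3) :: R
  end.

(* Reidemeister III on a triangle of strands T (top), M (middle), B (bottom);
   chords x = T over M, y = T over B, z = M over B.  Parameters: ccw = the
   counterclockwise cyclic order of the triangle's edges is (T,M,B) (else
   (T,B,M)); aX = strand X is oriented along the counterclockwise boundary. *)
Definition r3T (ccw aT aM aB : bool) (x y z : nat) : seq letter :=
  let sx := if ccw then aT == aM else aT != aM in
  let sy := if ccw then aB != aT else aT == aB in
  if aT == ccw then [:: (y, true, sy); (x, true, sx)]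
  else [:: (x, true, sx); (y, true, sy)].
Definition r3M (ccw aT aM aB : bool) (x y z : nat) : seq letter :=
  let sx := if ccw then aT == aM else aT != aM in
  let sz := if ccw then aM == aB else aB != aM in
  if aM == ccw then [:: (x, false, sx); (z, true, sz)]
  else [:: (z, true, sz); (x, false, sx)].
Definition r3B (ccw aT aM aB : bool) (x y z : nat) : seq letter :=
  let sy := if ccw then aB != aT else aT == aB in
  let sz := if ccw then aM == aB else aB != aM in
  if aB == ccw then [:: (z, false, sz); (y, false, sy)]
  else [:: (y, false, sy); (z, false, sz)].

(* Welded Reidemeister moves on Gauss diagrams (virtual moves are invisible). *)
Inductive welded_step : gauss -> gauss -> Prop :=
| ws_rot w R k : welded_step (w :: R) (rot k w :: R)
| ws_perm D D' : perm_eq D D' -> welded_step D D'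
| ws_relabel D (f : nat -> nat) : injective f ->
    welded_step D (map (map (fun l => (f (lid l), lover l, lsign l))) D)
| ws_R1 w R c o e : fresh c (w :: R) ->
    welded_step (w :: R) (([:: (c, o, e); (c, ~~ o, e)] ++ w) :: R)
| ws_R2 sh w1 w2 R c d e q : c != d ->
    fresh c (fill2 sh [::] [::] w1 w2 R) -> fresh d (fill2 sh [::] [::] w1 w2 R) ->
    welded_step (fill2 sh [::] [::] w1 w2 R)
      (fill2 sh [:: (c, true, e); (d, true, ~~ e)]
         (if q then [:: (c, false, e); (d, false, ~~ e)]
          else [:: (d, false, ~~ e); (c, false, e)]) w1 w2 R)
| ws_R3 sh w1 w2 w3 R x y z ccw aT aM aB : uniq [:: x; y; z] ->
    welded_step
      (fill3 sh (r3T ccw aT aM aB x y z) (r3M ccw aT aM aB x y z)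
         (r3B ccw aT aM aB x y z) w1 w2 w3 R)
      (fill3 sh (rev (r3T ccw aT aM aB x y z)) (rev (r3M ccw aT aM aB x y z))
         (rev (r3B ccw aT aM aB x y z)) w1 w2 w3 R)
| ws_OC a b w R : lover a -> lover b ->
    welded_step ((a :: b :: w) :: R) ((b :: a :: w) :: R).

Definition UC_step (D D' : gauss) : Prop :=
  exists a b w R, [/\ ~~ lover a, ~~ lover b,
    D = (a :: b :: w) :: R & D' = (b :: a :: w) :: R].

(* The two strands of the twist sigma^n (all crossings of sign e): the strand
   entering at the bottom-left / bottom-right of the disk. *)
Definition twA (cs : seq nat) (e : bool) : seq letter :=
  [seq (nth 0 cs i, ~~ odd i, e) | i <- iota 0 (size cs)].
Definition twB (cs : seq nat) (e : bool) : seq letter :=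
  [seq (nth 0 cs i, odd i, e) | i <- iota 0 (size cs)].

(* V(n)-move: left side = single virtual crossing, right side = twist. *)
Inductive Vn_step (n : nat) : gauss -> gauss -> Prop :=
| vn_odd sh w1 w2 R cs e : size cs = n -> odd n -> uniq cs ->
    all (fun c => fresh c (fill2 sh [::] [::] w1 w2 R)) cs ->
    Vn_step n (fill2 sh [::] [::] w1 w2 R) (fill2 sh (twA cs e) (twB cs e) w1 w2 R)
| vn_even1 a b R cs e : size cs = n -> ~~ odd n -> uniq cs ->
    all (fun c => fresh c (a :: b :: R)) cs ->
    Vn_step n (a :: b :: R) ((twA cs e ++ a ++ twB cs e ++ b) :: R)
| vn_even2 a b R cs e : size cs = n -> ~~ odd n -> uniq cs ->
    all (fun c => fresh c ((a ++ b) :: R)) cs ->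
    Vn_step n ((a ++ b) :: R) ((twA cs e ++ a) :: (twB cs e ++ b) :: R).

Definition Vn_equiv (n : nat) : relation gauss :=
  clos_refl_sym_trans gauss (fun D D' => welded_step D D' \/ Vn_step n D D').

(* Main.v *)
Require Import Defs.
From mathcomp Require Import all_boot zify.
Set Implicit Arguments. Unset Strict Implicit. Unset Printing Implicit Defensive.

(* Two adjacent heads of crossings p, q of the same sign are exchanged by a
   V(n)-move that makes the over-arcs of p and q run through a twist of n
   crossings: R3 moves slide both over-arcs through the twist, each of its
   crossings swapping the order in which they pass over the two heads, and a
   second V(n)-move removes the twist. For odd n this exchanges the heads; for
   even n the twist reconnects the strands and exchanges the two over-arcs
   instead, which amounts to the same after renaming p and q. Heads of
   opposite signs are reduced to this case with auxiliary R2 pairs, R3 and OC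
   moves, and a head is moved past an adjacent tail in the same way, so any
   two adjacent endpoints of distinct crossings commute (two tails by OC). In
   a one-component diagram the two endpoints of a crossing can therefore be
   made adjacent and the crossing removed by R1. *)

Lemma Vn_equiv_refl n D : Vn_equiv n D D.
Proof. exact: rst_refl. Qed.

Lemma Vn_equiv_sym n D D' : Vn_equiv n D D' -> Vn_equiv n D' D.
Proof. exact: rst_sym. Qed.

Lemma Vn_equiv_trans n D1 D2 D3 :
  Vn_equiv n D1 D2 -> Vn_equiv n D2 D3 -> Vn_equiv n D1 D3.
Proof. exact: rst_trans. Qed.

Lemma welded_Vn_equiv n D D' : welded_step D D' -> Vn_equiv n D D'.
Proof. by move=> h; apply: rst_step; left. Qed.

Lemma Vn_step_equiv n D D' : Vn_step n D D' -> Vn_equiv n D D'.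
Proof. by move=> h; apply: rst_step; right. Qed.

(* Gauss words are cyclic and circles unordered: [iso] identifies the
   encodings of one and the same diagram. *)
Inductive iso_step : gauss -> gauss -> Prop :=
| iso_step_rot w R k : iso_step (w :: R) (rot k w :: R)
| iso_step_perm D D' : perm_eq D D' -> iso_step D D'.

Definition iso := clos_refl_sym_trans gauss iso_step.

Lemma iso_refl D : iso D D. Proof. exact: rst_refl. Qed.
Lemma iso_sym D D' : iso D D' -> iso D' D. Proof. exact: rst_sym. Qed.
Lemma iso_trans D1 D2 D3 : iso D1 D2 -> iso D2 D3 -> iso D1 D3.
Proof. exact: rst_trans. Qed.

Lemma iso_rot w R k : iso (w :: R) (rot k w :: R).
Proof. by apply: rst_step; apply: iso_step_rot. Qed.

Lemma iso_perm D D' : perm_eq D D' -> iso D D'.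
Proof. by move=> h; apply: rst_step; apply: iso_step_perm. Qed.

Lemma iso_Vn_equiv n D D' : iso D D' -> Vn_equiv n D D'.
Proof.
elim=> {D D'} [? ? [w R k|D D' h]|D|D D' _|D1 D2 D3 _ h12 _ h23].
- exact/welded_Vn_equiv/ws_rot.
- exact/welded_Vn_equiv/ws_perm.
- exact: Vn_equiv_refl.
- exact: Vn_equiv_sym.
- exact: Vn_equiv_trans h12 h23.
Qed.

Lemma Vn_equiv_iso n X Y X' Y' :
  iso X X' -> iso Y Y' -> Vn_equiv n X' Y' -> Vn_equiv n X Y.
Proof.
move=> hX hY h; apply: Vn_equiv_trans (iso_Vn_equiv n hX) _.
exact: Vn_equiv_trans h (Vn_equiv_sym (iso_Vn_equiv n hY)).
Qed.

Lemma perm_flatten_iso D D' : iso D D' -> perm_eq (flatten D) (flatten D').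
Proof.
elim=> {D D'} [? ? [w R k|D D' h]|D|D D' _|D1 D2 D3 _ h12 _ h23].
- by rewrite /= perm_cat2r perm_sym perm_rot.
- exact: perm_flatten.
- exact: perm_refl.
- by rewrite perm_sym.
- exact: perm_trans h12 h23.
Qed.

Lemma perm_swap2 (T : eqType) (a b : T) s : perm_eq (a :: b :: s) (b :: a :: s).
Proof. by rewrite -[b :: s]cat1s -[a :: _]cat1s perm_catCA. Qed.

Lemma iso_cons w R R' : iso R R' -> iso (w :: R) (w :: R').
Proof.
elim=> {R R'} [? ? [w' R0 k|R R' h]|R|R R' _|R1 R2 R3 _ h12 _ h23].
- apply: iso_trans (iso_perm (perm_swap2 w w' R0)) _.
  apply: iso_trans (iso_rot _ _ k) (iso_perm (perm_swap2 _ _ _)).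
- by apply: iso_perm; rewrite perm_cons.
- exact: iso_refl.
- exact: iso_sym.
- exact: iso_trans h12 h23.
Qed.

Lemma iso_catr X Y R : iso X Y -> iso (X ++ R) (Y ++ R).
Proof.
elim=> {X Y} [? ? [w R0 k|X Y h]|X|X Y _|X1 X2 X3 _ h12 _ h23].
- exact: iso_rot.
- by apply: iso_perm; rewrite perm_cat2r.
- exact: iso_refl.
- exact: iso_sym.
- exact: iso_trans h12 h23.
Qed.

Lemma iso_consr w w' R : iso [:: w] [:: w'] -> iso (w :: R) (w' :: R).
Proof. exact: iso_catr. Qed.

Lemma iso_front (D1 D2 : gauss) w : iso (D1 ++ w :: D2) (w :: D1 ++ D2).
Proof. by apply: iso_perm; rewrite -cat1s perm_catCA. Qed.

Lemma fresh_iso c X Y : iso X Y -> fresh c X = fresh c Y.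
Proof. by move=> h; rewrite /fresh /ids (perm_mem (perm_map lid (perm_flatten_iso h))). Qed.

(* A sound check of [iso] for diagrams whose words are concatenations of
   opaque atoms [nth [::] env i], matching circles greedily up to rotation. *)
Definition interp (env : seq (seq letter)) (c : seq nat) : seq letter :=
  flatten [seq nth [::] env i | i <- c].
Definition idiag env (ds : seq (seq nat)) (R : gauss) : gauss :=
  [seq interp env c | c <- ds] ++ R.

Definition rotb (c d : seq nat) := has (fun k => rot k c == d) (iota 0 (size c).+1).
Definition rem_at (i : nat) (ds : seq (seq nat)) := take i ds ++ drop i.+1 ds.

Fixpoint isob (cs ds : seq (seq nat)) : bool :=
  if cs is c :: cs' then
    let i := find (rotb c) ds in (i < size ds) && isob cs' (rem_at i ds)
  else ds == [::].

Lemma iso_interp_rot env c k : iso [:: interp env c] [:: interp env (rot k c)].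
Proof.
rewrite /interp /rot -{1}[c](cat_take_drop k) !map_cat !flatten_cat.
set x := flatten _; set y := flatten _.
by have := iso_rot (x ++ y) [::] (size x); rewrite rot_size_cat.
Qed.

Lemma isob_sound env cs ds R : isob cs ds -> iso (idiag env cs R) (idiag env ds R).
Proof.
elim: cs ds => [|c cs ih] ds /=; first by move/eqP->; exact: iso_refl.
set i := find _ _ => /andP[hi /ih {}ih].
have /hasP[k _ /eqP hk] : rotb c (nth [::] ds i) by apply: nth_find; rewrite has_find.
have -> : ds = take i ds ++ nth [::] ds i :: drop i.+1 ds.
  by rewrite -drop_nth // cat_take_drop.
rewrite /idiag map_cat /=.
apply: (@iso_trans _ (interp env c :: idiag env (rem_at i ds) R)).
  exact: iso_cons.
apply: (@iso_trans _ (interp env (nth [::] ds i) :: idiag env (rem_at i ds) R)).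
  by apply: iso_consr; rewrite -hk; exact: iso_interp_rot.
by rewrite /idiag /rem_at map_cat -!catA; apply: iso_perm; rewrite -cat1s perm_catCA.
Qed.

Lemma isob_iso env cs ds R X Y :
  isob cs ds -> X = idiag env cs R -> Y = idiag env ds R -> iso X Y.
Proof. by move=> h -> ->; exact: isob_sound. Qed.

Ltac lookup a env :=
  lazymatch env with
  | a :: _ => constr:(0)
  | _ :: ?r => let k := lookup a r in constr:(S k)
  end.

Ltac reify_word env t :=
  match t with
  | ?a ++ ?b =>
      let ra := reify_word env a in let rb := reify_word env b in constr:(ra ++ rb)
  | [::] => constr:(@nil nat)
  | _ => let i := lookup t env in constr:([:: i])
  | ?x :: ?r =>
      let i := lookup [:: x] env in let rr := reify_word env r in constr:(i :: rr)
  end.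

Ltac reify_diag env R t :=
  lazymatch t with
  | R => constr:(@nil (seq nat))
  | ?c :: ?ds =>
      let rc := reify_word env c in let rds := reify_diag env R ds in constr:(rc :: rds)
  | [::] => constr:(@nil (seq nat))
  end.

(* [iso_solve env R] proves [iso X Y] when X and Y are built from the atoms in
   [env] and share the tail of circles [R]. *)
Ltac iso_solve env R :=
  rewrite /idiag /interp /= ?cats0;
  lazymatch goal with
  | |- iso ?X ?Y =>
    let cx := reify_diag env R X in let cy := reify_diag env R Y in
    apply: (@isob_iso env cx cy R X Y);
    [ by vm_compute | by rewrite /idiag /interp /= ?cats0 -?catA
    | by rewrite /idiag /interp /= ?cats0 -?catA ]
  end.

(** * Local moves *)

(* The six placements of three segments [s_i], each followed by a context word
   [w_i], on one, two or three circles; up to [iso] every placement of three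
   disjoint segments is one of them. *)
Definition shape3 (sg : nat) : seq (seq nat) :=
  match sg with
  | 0 => [:: [:: 0; 1; 2; 3; 4; 5]]
  | 1 => [:: [:: 0; 1; 4; 5; 2; 3]]
  | 2 => [:: [:: 0; 1; 2; 3]; [:: 4; 5]]
  | 3 => [:: [:: 0; 1; 4; 5]; [:: 2; 3]]
  | 4 => [:: [:: 0; 1]; [:: 2; 3; 4; 5]]
  | _ => [:: [:: 0; 1]; [:: 2; 3]; [:: 4; 5]]
  end.

Definition place3 sg (s1 s2 s3 w1 w2 w3 : seq letter) (R : gauss) : gauss :=
  idiag [:: s1; w1; s2; w2; s3; w3] (shape3 sg) R.

Definition fresh_labels (L : seq nat) (D : gauss) := forall c, c \in L -> fresh c D.

(* A local move replacing the segments [s_i] by [t_i] in every context where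
   the labels in [L], reserved for auxiliary crossings, do not occur. *)
Definition Vn_local n (L : seq nat) (s1 s2 s3 t1 t2 t3 : seq letter) :=
  forall sg w1 w2 w3 R, fresh_labels L [:: w1, w2, w3 & R] ->
    Vn_equiv n (place3 sg s1 s2 s3 w1 w2 w3 R) (place3 sg t1 t2 t3 w1 w2 w3 R).

Ltac mem_solve :=
  let x := fresh "x" in
  move=> x; rewrite /= ?mem_cat ?cats0 ?inE;
  repeat match goal with
  | |- context [x \in ?a] => case: (x \in a)
  | |- context [x == ?a] => case: (x == a)
  end; by [].

Lemma fresh_labels_subset2 L D D1 D2 : fresh_labels L D1 -> fresh_labels L D2 ->
  {subset flatten D <= flatten D1 ++ flatten D2} -> fresh_labels L D.
Proof.
move=> h1 h2 hs c hc; apply/mapP => -[x /hs]; rewrite mem_cat => /orP[] hx ex.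
- by move: (h1 c hc); rewrite /fresh /ids ex map_f.
- by move: (h2 c hc); rewrite /fresh /ids ex map_f.
Qed.

Lemma fresh_labels_subset L D D1 :
  fresh_labels L D1 -> {subset flatten D <= flatten D1} -> fresh_labels L D.
Proof.
move=> h1 hs; apply: (fresh_labels_subset2 h1 (D2 := [::])) => //.
by move=> x /hs; rewrite cats0.
Qed.

Lemma fresh_labels_nil D : fresh_labels [::] D.
Proof. by []. Qed.

Section LocalEquivalence.

Variable n : nat.

Lemma Vn_local_refl L s1 s2 s3 : Vn_local n L s1 s2 s3 s1 s2 s3.
Proof. by move=> sg w1 w2 w3 R _; exact: Vn_equiv_refl. Qed.

Lemma Vn_local_sym L s1 s2 s3 t1 t2 t3 :
  Vn_local n L s1 s2 s3 t1 t2 t3 -> Vn_local n L t1 t2 t3 s1 s2 s3.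
Proof. by move=> h sg w1 w2 w3 R hf; apply/Vn_equiv_sym/h. Qed.

Lemma Vn_local_trans L s1 s2 s3 t1 t2 t3 u1 u2 u3 :
  Vn_local n L s1 s2 s3 t1 t2 t3 -> Vn_local n L t1 t2 t3 u1 u2 u3 ->
  Vn_local n L s1 s2 s3 u1 u2 u3.
Proof.
by move=> h1 h2 sg w1 w2 w3 R hf; exact: Vn_equiv_trans (h1 _ _ _ _ _ hf) (h2 _ _ _ _ _ hf).
Qed.

Lemma Vn_local_sub L L' s1 s2 s3 t1 t2 t3 : {subset L <= L'} ->
  Vn_local n L s1 s2 s3 t1 t2 t3 -> Vn_local n L' s1 s2 s3 t1 t2 t3.
Proof. by move=> hs h sg w1 w2 w3 R hf; apply: h => c /hs; exact: hf. Qed.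

Lemma Vn_local_transport L L' (f : seq letter -> seq letter -> seq letter ->
    seq letter * seq letter * seq letter) s1 s2 s3 t1 t2 t3 :
  Vn_local n L s1 s2 s3 t1 t2 t3 ->
  (forall sg w1 w2 w3 R, fresh_labels L' [:: w1, w2, w3 & R] ->
     exists sg' w1' w2' w3' R', fresh_labels L [:: w1', w2', w3' & R'] /\
       forall a b c, iso (place3 sg (f a b c).1.1 (f a b c).1.2 (f a b c).2 w1 w2 w3 R)
                         (place3 sg' a b c w1' w2' w3' R')) ->
  Vn_local n L' (f s1 s2 s3).1.1 (f s1 s2 s3).1.2 (f s1 s2 s3).2
                (f t1 t2 t3).1.1 (f t1 t2 t3).1.2 (f t1 t2 t3).2.
Proof.
move=> h ht sg w1 w2 w3 R hf.
have [sg' [w1' [w2' [w3' [R' [hf' hi]]]]]] := ht sg w1 w2 w3 R hf.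
exact: Vn_equiv_iso (hi _ _ _) (hi _ _ _) (h _ _ _ _ _ hf').
Qed.

Definition swap12_shape sg :=
  match sg with 0 => 1 | 1 => 0 | 2 => 2 | 3 => 4 | 4 => 3 | _ => 5 end.
Definition swap23_shape sg :=
  match sg with 0 => 1 | 1 => 0 | 2 => 3 | 3 => 2 | 4 => 4 | _ => 5 end.

Lemma Vn_local_swap12 L s1 s2 s3 t1 t2 t3 :
  Vn_local n L s1 s2 s3 t1 t2 t3 -> Vn_local n L s2 s1 s3 t2 t1 t3.
Proof.
move=> h; apply: (Vn_local_transport (f := fun a b c => (b, a, c)) h) => sg w1 w2 w3 R hf.
exists (swap12_shape sg), w2, w1, w3, R.
split; first by apply: fresh_labels_subset hf _; mem_solve.
move=> a b c; case: sg {hf} => [|[|[|[|[|sg]]]]]; rewrite /place3 /=.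
all: iso_solve [:: b; w1; a; w2; c; w3] R.
Qed.

Lemma Vn_local_swap23 L s1 s2 s3 t1 t2 t3 :
  Vn_local n L s1 s2 s3 t1 t2 t3 -> Vn_local n L s1 s3 s2 t1 t3 t2.
Proof.
move=> h; apply: (Vn_local_transport (f := fun a b c => (a, c, b)) h) => sg w1 w2 w3 R hf.
exists (swap23_shape sg), w1, w3, w2, R.
split; first by apply: fresh_labels_subset hf _; mem_solve.
move=> a b c; case: sg {hf} => [|[|[|[|[|sg]]]]]; rewrite /place3 /=.
all: iso_solve [:: a; w1; c; w2; b; w3] R.
Qed.

Lemma Vn_local_catr L s1 s2 s3 t1 t2 t3 v1 v2 v3 :
  Vn_local n L s1 s2 s3 t1 t2 t3 -> fresh_labels L [:: v1; v2; v3] ->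
  Vn_local n L (s1 ++ v1) (s2 ++ v2) (s3 ++ v3) (t1 ++ v1) (t2 ++ v2) (t3 ++ v3).
Proof.
move=> h hv; apply: (Vn_local_transport (f := fun a b c => (a ++ v1, b ++ v2, c ++ v3)) h).
move=> sg w1 w2 w3 R hf; exists sg, (v1 ++ w1), (v2 ++ w2), (v3 ++ w3), R; split.
  by apply: fresh_labels_subset2 hf hv _; mem_solve.
move=> a b c; case: sg {hf} => [|[|[|[|[|sg]]]]]; rewrite /place3 /=.
all: iso_solve [:: a; v1; w1; b; v2; w2; c; v3; w3] R.
Qed.

Lemma Vn_local_catl1 L s1 s2 s3 t1 t2 t3 u :
  Vn_local n L s1 s2 s3 t1 t2 t3 -> fresh_labels L [:: u] ->
  Vn_local n L (u ++ s1) s2 s3 (u ++ t1) t2 t3.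
Proof.
move=> h hu; apply: (Vn_local_transport (f := fun a b c => (u ++ a, b, c)) h).
move=> sg w1 w2 w3 R hf.
have hA x y z : {subset flatten [:: x, y, z & R] <=
    flatten [:: w1, w2, w3 & R] ++ flatten [:: u]} -> fresh_labels L [:: x, y, z & R].
  exact: fresh_labels_subset2 hf hu.
case: sg => [|[|[|[|[|sg]]]]]; [exists 0, w1, w2, (w3 ++ u), R | exists 1, w1, (w2 ++ u), w3, R
  | exists 2, w1, (w2 ++ u), w3, R | exists 3, w1, w2, (w3 ++ u), R
  | exists 4, (w1 ++ u), w2, w3, R | exists 5, (w1 ++ u), w2, w3, R].
all: split; first by apply: hA; mem_solve.
all: by move=> a b c; rewrite /place3 /=; iso_solve [:: u; a; w1; b; w2; c; w3] R.
Qed.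

Lemma Vn_local_catl2 L s1 s2 s3 t1 t2 t3 u :
  Vn_local n L s1 s2 s3 t1 t2 t3 -> fresh_labels L [:: u] ->
  Vn_local n L s1 (u ++ s2) s3 t1 (u ++ t2) t3.
Proof. by move=> h hu; apply/Vn_local_swap12/Vn_local_catl1/hu/Vn_local_swap12. Qed.

Lemma Vn_local_catl3 L s1 s2 s3 t1 t2 t3 u :
  Vn_local n L s1 s2 s3 t1 t2 t3 -> fresh_labels L [:: u] ->
  Vn_local n L s1 s2 (u ++ s3) t1 t2 (u ++ t3).
Proof. by move=> h hu; apply/Vn_local_swap23/Vn_local_catl2/hu/Vn_local_swap23. Qed.

Lemma Vn_local_embed L s1 s2 s3 t1 t2 t3 u1 v1 u2 v2 u3 v3 :
  Vn_local n L s1 s2 s3 t1 t2 t3 -> fresh_labels L [:: u1; v1; u2; v2; u3; v3] ->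
  Vn_local n L (u1 ++ s1 ++ v1) (u2 ++ s2 ++ v2) (u3 ++ s3 ++ v3)
               (u1 ++ t1 ++ v1) (u2 ++ t2 ++ v2) (u3 ++ t3 ++ v3).
Proof.
move=> h hf.
have hs x : x \in [:: u1; v1; u2; v2; u3; v3] -> fresh_labels L [:: x].
  move=> hx; apply: fresh_labels_subset hf _ => y; rewrite [flatten [:: x]]/= cats0 => hy.
  by apply/flattenP; exists x.
apply: Vn_local_catl1; last by apply: hs; rewrite !inE eqxx.
apply: Vn_local_catl2; last by apply: hs; rewrite !inE eqxx !orbT.
apply: Vn_local_catl3; last by apply: hs; rewrite !inE eqxx !orbT.
by apply: Vn_local_catr => //; apply: fresh_labels_subset hf _; mem_solve.
Qed.

Lemma Vn_local_in_context u1 v1 u2 v2 u3 v3 L L' s1 s2 s3 t1 t2 t3 :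
  Vn_local n L s1 s2 s3 t1 t2 t3 -> {subset L <= L'} ->
  fresh_labels L [:: u1; v1; u2; v2; u3; v3] ->
  Vn_local n L' (u1 ++ s1 ++ v1) (u2 ++ s2 ++ v2) (u3 ++ s3 ++ v3)
                (u1 ++ t1 ++ v1) (u2 ++ t2 ++ v2) (u3 ++ t3 ++ v3).
Proof. by move=> h hL hf; apply: Vn_local_sub hL (Vn_local_embed h hf). Qed.

End LocalEquivalence.

Arguments Vn_local_in_context n u1 v1 u2 v2 u3 v3 [L L' s1 s2 s3 t1 t2 t3].

Lemma place3_fill3 sg w1 w2 w3 R : exists sh w1' w2' w3' R', forall a b c,
  iso (place3 sg a b c w1 w2 w3 R) (fill3 sh a b c w1' w2' w3' R').
Proof.
case: sg => [|[|[|[|[|sg]]]]]; [exists 0, w1, w2, w3, R | exists 1, w1, w3, w2, R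
  | exists 2, w1, w2, w3, R | exists 3, w1, w3, w2, R
  | exists 4, w2, w3, w1, R | exists 5, w1, w2, w3, R].
all: by move=> a b c; rewrite /place3 /=; iso_solve [:: a; w1; b; w2; c; w3] R.
Qed.

Lemma place3_fill2 sg w1 w2 w3 R : exists sh w1' w2' R',
  {subset flatten [:: w1', w2' & R'] <= flatten [:: w1, w2, w3 & R]} /\
  forall a b, iso (place3 sg a b [::] w1 w2 w3 R) (fill2 sh a b w1' w2' R').
Proof.
case: sg => [|[|[|[|[|sg]]]]]; [exists true, w1, (w2 ++ w3), R
  | exists true, (w1 ++ w3), w2, R | exists true, w1, w2, (w3 :: R)
  | exists false, (w1 ++ w3), w2, R | exists false, w1, (w2 ++ w3), R
  | exists false, w1, w2, (w3 :: R)].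
all: split; first by mem_solve.
all: by move=> a b; rewrite /place3 /fill2 /=; iso_solve [:: a; w1; b; w2; w3] R.
Qed.

Section LocalMoves.

Variable n : nat.

Lemma Vn_local_of_fill3 L s1 s2 s3 t1 t2 t3 :
  (forall sh w1 w2 w3 R,
     Vn_equiv n (fill3 sh s1 s2 s3 w1 w2 w3 R) (fill3 sh t1 t2 t3 w1 w2 w3 R)) ->
  Vn_local n L s1 s2 s3 t1 t2 t3.
Proof.
move=> h sg w1 w2 w3 R _.
have [sh [w1' [w2' [w3' [R' hi]]]]] := place3_fill3 sg w1 w2 w3 R.
exact: Vn_equiv_iso (hi _ _ _) (hi _ _ _) (h _ _ _ _ _).
Qed.

Lemma Vn_local_of_fill2 L s1 s2 t1 t2 :
  (forall sh w1 w2 R, fresh_labels L [:: w1, w2 & R] ->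
     Vn_equiv n (fill2 sh s1 s2 w1 w2 R) (fill2 sh t1 t2 w1 w2 R)) ->
  Vn_local n L s1 s2 [::] t1 t2 [::].
Proof.
move=> h sg w1 w2 w3 R hf.
have [sh [w1' [w2' [R' [hs hi]]]]] := place3_fill2 sg w1 w2 w3 R.
exact: Vn_equiv_iso (hi _ _) (hi _ _) (h _ _ _ _ (fresh_labels_subset hf hs)).
Qed.

Lemma Vn_local_of_head L s t :
  (forall w R, fresh_labels L (w :: R) -> Vn_equiv n ((s ++ w) :: R) ((t ++ w) :: R)) ->
  Vn_local n L s [::] [::] t [::] [::].
Proof.
move=> h; apply: Vn_local_of_fill2 => -[] w1 w2 R hf; apply: h.
all: by apply: fresh_labels_subset hf _; mem_solve.
Qed.

Definition O c s : letter := (c, true, s).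
Definition U c s : letter := (c, false, s).

Lemma Vn_local_R3 L ccw aT aM aB x y z : uniq [:: x; y; z] ->
  Vn_local n L (r3T ccw aT aM aB x y z) (r3M ccw aT aM aB x y z) (r3B ccw aT aM aB x y z)
    (rev (r3T ccw aT aM aB x y z)) (rev (r3M ccw aT aM aB x y z)) (rev (r3B ccw aT aM aB x y z)).
Proof. by move=> hu; apply: Vn_local_of_fill3 => *; apply/welded_Vn_equiv/ws_R3. Qed.

Lemma Vn_local_R3_slide L x y z s : uniq [:: x; y; z] ->
  Vn_local n L [:: O y s; O x (~~ s)] [:: O z s; U x (~~ s)] [:: U y s; U z s]
               [:: O x (~~ s); O y s] [:: U x (~~ s); O z s] [:: U z s; U y s].
Proof.
by case: s => hu; [have := Vn_local_R3 (L := L) true true false false hu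
                  | have := Vn_local_R3 (L := L) false false true true hu].
Qed.

Lemma Vn_local_R3_opp L x y z s : uniq [:: x; y; z] ->
  Vn_local n L [:: O y s; O x s] [:: U x s; O z (~~ s)] [:: U y s; U z (~~ s)]
               [:: O x s; O y s] [:: O z (~~ s); U x s] [:: U z (~~ s); U y s].
Proof.
by case: s => hu; [have := Vn_local_R3 (L := L) true true true false hu
                  | have := Vn_local_R3 (L := L) false false false true hu].
Qed.

Lemma Vn_local_R3_mix L x y z s : uniq [:: x; y; z] ->
  Vn_local n L [:: O y (~~ s); O x s] [:: U x s; O z s] [:: U z s; U y (~~ s)]
               [:: O x s; O y (~~ s)] [:: O z s; U x s] [:: U y (~~ s); U z s].
Proof.
by case: s => hu; [have := Vn_local_R3 (L := L) true true true true hu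
                  | have := Vn_local_R3 (L := L) false false false false hu].
Qed.

Lemma fresh_fill2 c sh w1 w2 R :
  fresh c [:: w1, w2 & R] -> fresh c (fill2 sh [::] [::] w1 w2 R).
Proof. by rewrite /fresh /ids /fill2; case: sh => /=; rewrite !catA. Qed.

Lemma Vn_local_R2 c d e q : c != d ->
  Vn_local n [:: c; d] [::] [::] [::] [:: O c e; O d (~~ e)]
    (if q then [:: U c e; U d (~~ e)] else [:: U d (~~ e); U c e]) [::].
Proof.
move=> hcd; apply: Vn_local_of_fill2 => sh w1 w2 R hf.
by apply/welded_Vn_equiv/ws_R2 => //; apply/fresh_fill2/hf; rewrite !inE eqxx ?orbT.
Qed.

Lemma Vn_local_Vodd cs e : size cs = n -> odd n -> uniq cs ->
  Vn_local n cs [::] [::] [::] (twA cs e) (twB cs e) [::].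
Proof.
move=> hs ho hu; apply: Vn_local_of_fill2 => sh w1 w2 R hf.
by apply/Vn_step_equiv/vn_odd => //; apply/allP => c /hf /fresh_fill2.
Qed.

Lemma Vn_local_OC L a b : lover a -> lover b ->
  Vn_local n L [:: a; b] [::] [::] [:: b; a] [::] [::].
Proof. by move=> ha hb; apply: Vn_local_of_head => w R _; apply/welded_Vn_equiv/ws_OC. Qed.

End LocalMoves.

(** * Exchanging two heads of the same sign *)

(* An even twist joins the strands crosswise: the context words following the
   first two segments are exchanged, and circles are merged or split. *)
Definition cross_shape sg :=
  match sg with 0 => 3 | 1 => 4 | 2 => 5 | 3 => 0 | 4 => 1 | _ => 2 end.

Lemma all_fresh_iso cs X Y :
  iso X Y -> all (fun c => fresh c X) cs -> all (fun c => fresh c Y) cs.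
Proof. by move=> h /allP a; apply/allP => c /a; rewrite (fresh_iso c h). Qed.

Lemma Vn_equiv_even_twist n sg s1 s2 s3 w1 w2 w3 R cs e :
  size cs = n -> ~~ odd n -> uniq cs ->
  all (fun c => fresh c (place3 sg s1 s2 s3 w1 w2 w3 R)) cs ->
  Vn_equiv n (place3 sg s1 s2 s3 w1 w2 w3 R)
    (place3 (cross_shape sg) (s1 ++ twA cs e) (s2 ++ twB cs e) s3 w2 w1 w3 R).
Proof.
move=> hs ho hu.
case: sg => [|[|[|[|[|sg]]]]] hf.
- have i : iso (place3 0 s1 s2 s3 w1 w2 w3 R) (((w2 ++ s3 ++ w3 ++ s1) ++ (w1 ++ s2)) :: R).
    by rewrite /place3 /=; iso_solve [:: s1; w1; s2; w2; s3; w3] R.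
  apply: Vn_equiv_iso i _ (Vn_step_equiv (vn_even2 e hs ho hu (all_fresh_iso i hf))).
  by rewrite /place3 /=; iso_solve [:: s1; twA cs e; w1; s2; twB cs e; w2; s3; w3] R.
- have i : iso (place3 1 s1 s2 s3 w1 w2 w3 R) (((w2 ++ s1) ++ (w1 ++ s3 ++ w3 ++ s2)) :: R).
    by rewrite /place3 /=; iso_solve [:: s1; w1; s2; w2; s3; w3] R.
  apply: Vn_equiv_iso i _ (Vn_step_equiv (vn_even2 e hs ho hu (all_fresh_iso i hf))).
  by rewrite /place3 /=; iso_solve [:: s1; twA cs e; w1; s2; twB cs e; w2; s3; w3] R.
- have i : iso (place3 2 s1 s2 s3 w1 w2 w3 R) (((w2 ++ s1) ++ (w1 ++ s2)) :: (s3 ++ w3) :: R).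
    by rewrite /place3 /=; iso_solve [:: s1; w1; s2; w2; s3; w3] R.
  apply: Vn_equiv_iso i _ (Vn_step_equiv (vn_even2 e hs ho hu (all_fresh_iso i hf))).
  by rewrite /place3 /=; iso_solve [:: s1; twA cs e; w1; s2; twB cs e; w2; s3; w3] R.
- have i : iso (place3 3 s1 s2 s3 w1 w2 w3 R) ((w2 ++ s2) :: (w1 ++ s3 ++ w3 ++ s1) :: R).
    by rewrite /place3 /=; iso_solve [:: s1; w1; s2; w2; s3; w3] R.
  apply: Vn_equiv_iso i _ (Vn_step_equiv (vn_even1 e hs ho hu (all_fresh_iso i hf))).
  by rewrite /place3 /=; iso_solve [:: s1; twA cs e; w1; s2; twB cs e; w2; s3; w3] R.
- have i : iso (place3 4 s1 s2 s3 w1 w2 w3 R) ((w2 ++ s3 ++ w3 ++ s2) :: (w1 ++ s1) :: R).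
    by rewrite /place3 /=; iso_solve [:: s1; w1; s2; w2; s3; w3] R.
  apply: Vn_equiv_iso i _ (Vn_step_equiv (vn_even1 e hs ho hu (all_fresh_iso i hf))).
  by rewrite /place3 /=; iso_solve [:: s1; twA cs e; w1; s2; twB cs e; w2; s3; w3] R.
- have i : iso (place3 sg.+4.+1 s1 s2 s3 w1 w2 w3 R)
                ((w2 ++ s2) :: (w1 ++ s1) :: (s3 ++ w3) :: R).
    by rewrite /place3 /=; iso_solve [:: s1; w1; s2; w2; s3; w3] R.
  apply: Vn_equiv_iso i _ (Vn_step_equiv (vn_even1 e hs ho hu (all_fresh_iso i hf))).
  by rewrite /place3 /=; iso_solve [:: s1; twA cs e; w1; s2; twB cs e; w2; s3; w3] R.
Qed.

Lemma size_twA cs e : size (twA cs e) = size cs.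
Proof. by rewrite /twA size_map size_iota. Qed.

Lemma size_twB cs e : size (twB cs e) = size cs.
Proof. by rewrite /twB size_map size_iota. Qed.

Lemma nth_twA cs e k : k < size cs ->
  nth (0, false, false) (twA cs e) k = (nth 0 cs k, ~~ odd k, e).
Proof. by move=> hk; rewrite /twA (nth_map 0) ?size_iota // nth_iota. Qed.

Lemma nth_twB cs e k : k < size cs ->
  nth (0, false, false) (twB cs e) k = (nth 0 cs k, odd k, e).
Proof. by move=> hk; rewrite /twB (nth_map 0) ?size_iota // nth_iota. Qed.

Section SlideThroughTwist.

Variables (n p q : nat) (s : bool) (cs : seq nat).
Hypotheses (hpq : p != q) (hp : p \notin cs) (hq : q \notin cs).

Let A := twA cs (~~ s).
Let B := twB cs (~~ s).

(* Each crossing of the twist passed by the two over-arcs exchanges the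
   order in which they pass over the heads. *)
Definition heads_after k := if odd k then [:: U q s; U p s] else [:: U p s; U q s].

Lemma Vn_local_slide_step k : k < size cs ->
  Vn_local n [::] (take k A ++ O p s :: drop k A) (take k B ++ O q s :: drop k B)
    (heads_after k) (take k.+1 A ++ O p s :: drop k.+1 A)
    (take k.+1 B ++ O q s :: drop k.+1 B) (heads_after k.+1).
Proof.
move=> hk; have hkA : k < size A by rewrite size_twA.
have hkB : k < size B by rewrite size_twB.
set x := nth 0 cs k.
have hx : x \in cs by rewrite mem_nth.
have hxp : x != p by apply: contraNneq hp => <-.
have hxq : x != q by apply: contraNneq hq => <-.
rewrite !(take_nth (0, false, false)) // (drop_nth (0, false, false) hkA).
rewrite (drop_nth (0, false, false) hkB) nth_twA // nth_twB // -/x -!cats1.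
rewrite /heads_after /=; case: (odd k) => /=.
- have hu : uniq [:: x; q; p] by rewrite /= !inE negb_or hxp hxq eq_sym hpq.
  have := Vn_local_embed (u1 := take k A) (v1 := drop k.+1 A) (u2 := take k B)
    (v2 := drop k.+1 B) (u3 := [::]) (v3 := [::])
    (Vn_local_swap12 (Vn_local_R3_slide n (L := [::]) s hu)) (fresh_labels_nil _).
  by rewrite !cats0 -!catA.
- have hu : uniq [:: x; p; q] by rewrite /= !inE negb_or hxp hxq hpq.
  have := Vn_local_embed (u1 := take k A) (v1 := drop k.+1 A) (u2 := take k B)
    (v2 := drop k.+1 B) (u3 := [::]) (v3 := [::])
    (Vn_local_R3_slide n (L := [::]) s hu) (fresh_labels_nil _).
  by rewrite !cats0 -!catA.
Qed.

Lemma Vn_local_slide :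
  Vn_local n [::] (O p s :: A) (O q s :: B) [:: U p s; U q s]
    (A ++ [:: O p s]) (B ++ [:: O q s]) (heads_after (size cs)).
Proof.
suff h k : k <= size cs -> Vn_local n [::] (O p s :: A) (O q s :: B) [:: U p s; U q s]
    (take k A ++ O p s :: drop k A) (take k B ++ O q s :: drop k B) (heads_after k).
  by have := h _ (leqnn _); rewrite !take_oversize ?drop_oversize ?size_twA ?size_twB.
elim: k => [|k ih] hk; first by rewrite !take0 !drop0; exact: Vn_local_refl.
exact: Vn_local_trans (ih (ltnW hk)) (Vn_local_slide_step hk).
Qed.

End SlideThroughTwist.

Lemma perm_flatten_place3 sg a b c w1 w2 w3 R :
  perm_eq (flatten (place3 sg a b c w1 w2 w3 R)) (a ++ b ++ c ++ flatten [:: w1, w2, w3 & R]).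
Proof.
case: sg => [|[|[|[|[|sg]]]]]; rewrite /place3 /idiag /interp /= ?cats0;
  apply/permP => P; rewrite !count_cat; lia.
Qed.

Lemma fresh_place3 c sg a b d w1 w2 w3 R :
  fresh c [:: a; b; d] -> fresh c [:: w1, w2, w3 & R] ->
  fresh c (place3 sg a b d w1 w2 w3 R).
Proof.
rewrite /fresh /ids (perm_mem (perm_map lid (perm_flatten_place3 _ _ _ _ _ _ _ _))).
by rewrite /= !map_cat !mem_cat /= orbF !negb_or => /and3P[-> -> ->].
Qed.

Lemma place3_cat2 sg a b c v1 v2 w1 w2 w3 R :
  place3 sg (a ++ v1) (b ++ v2) c w1 w2 w3 R = place3 sg a b c (v1 ++ w1) (v2 ++ w2) w3 R.
Proof. by case: sg => [|[|[|[|[|sg]]]]]; rewrite /place3 /idiag /interp /= ?cats0 -!catA. Qed.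

Definition relabel (f : nat -> nat) (w : seq letter) : seq letter :=
  [seq (f (lid l), lover l, lsign l) | l <- w].

Lemma relabel_place3 f sg a b c w1 w2 w3 R :
  map (relabel f) (place3 sg a b c w1 w2 w3 R) =
  place3 sg (relabel f a) (relabel f b) (relabel f c)
            (relabel f w1) (relabel f w2) (relabel f w3) (map (relabel f) R).
Proof.
by case: sg => [|[|[|[|[|sg]]]]]; rewrite /place3 /idiag /interp /relabel /= ?cats0 !map_cat.
Qed.

Lemma letter_eta (l : letter) : l = (lid l, lover l, lsign l).
Proof. by case: l => [[]]. Qed.

Lemma Vn_local_relabel n L f s1 s2 s3 : injective f -> (forall c, c \notin L -> f c = c) ->
  Vn_local n L s1 s2 s3 (relabel f s1) (relabel f s2) (relabel f s3).
Proof.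
move=> finj hf sg w1 w2 w3 R hL.
have hctx : {in [:: w1, w2, w3 & R], relabel f =1 id}.
  move=> w hw; apply: map_id_in => l hl; rewrite hf -?letter_eta //.
  apply/negP => /hL /negP; apply; apply/map_f/flattenP; by exists w.
have hR : map (relabel f) R = R by apply: map_id_in => w hw; apply: hctx; rewrite !inE hw !orbT.
have [h1 h2 h3] : [/\ relabel f w1 = w1, relabel f w2 = w2 & relabel f w3 = w3].
  by split; apply: hctx; rewrite !inE eqxx ?orbT.
have := welded_Vn_equiv n (@ws_relabel (place3 sg s1 s2 s3 w1 w2 w3 R) f finj).
by rewrite -/(relabel f) relabel_place3 hR h1 h2 h3.
Qed.

Definition swap_label (p q c : nat) := if c == p then q else if c == q then p else c.

Lemma swap_label_inj p q : injective (swap_label p q).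
Proof.
move=> a b; rewrite /swap_label.
by case: (a =P p) => ?; case: (a =P q) => ?; case: (b =P p) => ?; case: (b =P q) => ?; lia.
Qed.

Lemma swap_label_id p q c : c \notin [:: p; q] -> swap_label p q c = c.
Proof. by rewrite !inE negb_or /swap_label => /andP[/negbTE-> /negbTE->]. Qed.

Section SameSign.

Variables (n p q : nat) (s : bool) (cs : seq nat).
Hypotheses (hs : size cs = n) (hu : uniq cs) (hpq : p != q) (hp : p \notin cs) (hq : q \notin cs).

Let heads := [:: U p s; U q s].

Lemma fresh_labels_pq (D : gauss) : {subset flatten D <= [:: O p s; O q s; U p s; U q s]} ->
  fresh_labels cs D.
Proof.
move=> hD c hc; apply/mapP => -[l /hD]; rewrite !inE => /or4P[] /eqP-> ec; subst c.
all: by [exact: (negP hp hc) | exact: (negP hq hc)].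
Qed.

Lemma Vn_local_UC_same_odd : odd n ->
  Vn_local n cs [:: O p s] [:: O q s] heads [:: O p s] [:: O q s] [:: U q s; U p s].
Proof.
move=> ho; have hV := Vn_local_Vodd (~~ s) hs ho hu.
have f1 : fresh_labels cs [:: [:: O p s]; [::]; [:: O q s]; [::]; [::]; heads].
  by apply: fresh_labels_pq; mem_solve.
have f2 : fresh_labels cs [:: [::]; [:: O p s]; [::]; [:: O q s]; [::]; [:: U q s; U p s]].
  by apply: fresh_labels_pq; mem_solve.
have h1 := Vn_local_embed hV f1; have h2 := Vn_local_embed hV f2.
rewrite /= !cats0 in h1 h2.
apply: Vn_local_trans h1 (Vn_local_trans _ (Vn_local_sym h2)).
have := Vn_local_slide n s hpq hp hq; rewrite /heads_after hs ho => hsl.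
by apply: Vn_local_sub hsl.
Qed.

(* For even n the twist reconnects the strands, so sliding the two tails
   through it exchanges their positions instead of the heads. *)
Lemma Vn_local_exchange_tails_even : ~~ odd n ->
  Vn_local n cs [:: O p s] [:: O q s] heads [:: O q s] [:: O p s] heads.
Proof.
move=> ho sg w1 w2 w3 R hf.
have fresh_tails a b : {subset a ++ b <= [:: O p s; O q s]} ->
    all (fun c => fresh c (place3 sg a b heads w1 w2 w3 R)) cs.
  move=> hab; apply/allP => c hc; apply: fresh_place3 (hf c hc).
  apply: fresh_labels_pq hc => l /=; rewrite catA mem_cat => /orP[/hab|];
    by rewrite !inE => /orP[] ->; rewrite ?orbT.
have e1 := Vn_equiv_even_twist (~~ s) hs ho hu
  (fresh_tails [:: O p s] [:: O q s] (fun l hl => hl)).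
have e2 := Vn_local_slide n s hpq hp hq (cross_shape sg) (fresh_labels_nil [:: w2, w1, w3 & R]).
have fr3 : all (fun c => fresh c (place3 sg [::] [::] heads ([:: O q s] ++ w1)
                                          ([:: O p s] ++ w2) w3 R)) cs.
  by rewrite -place3_cat2; apply: fresh_tails; mem_solve.
have e3 := Vn_equiv_even_twist (~~ s) hs ho hu fr3.
rewrite -!place3_cat2 /= in e3; rewrite /heads_after hs (negbTE ho) in e2.
exact: Vn_equiv_trans e1 (Vn_equiv_trans e2 (Vn_equiv_sym e3)).
Qed.

Lemma Vn_local_UC_same :
  Vn_local n [:: p, q & cs] [:: O p s] [:: O q s] heads [:: O p s] [:: O q s] [:: U q s; U p s].
Proof.
have hsub : {subset cs <= [:: p, q & cs]} by move=> c hc; rewrite !inE hc !orbT.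
case ho : (odd n); first exact: Vn_local_sub hsub (Vn_local_UC_same_odd ho).
apply: Vn_local_trans (Vn_local_sub hsub (Vn_local_exchange_tails_even (negbT ho))) _.
have := Vn_local_relabel n (L := [:: p; q]) [:: O q s] [:: O p s] heads
  (@swap_label_inj p q) (@swap_label_id p q).
rewrite /relabel /= /swap_label /= eqxx (negbTE hpq) eq_sym (negbTE hpq) eqxx.
by apply: Vn_local_sub => c; rewrite !inE => /orP[] ->; rewrite ?orbT.
Qed.

End SameSign.

Lemma Vn_local_UC_same_iota n p q k s : p != q -> p < k -> q < k ->
  Vn_local n [:: p, q & iota k n] [:: O p s] [:: O q s] [:: U p s; U q s]
                                  [:: O p s] [:: O q s] [:: U q s; U p s].
Proof.
move=> hpq hp hq.
by apply: (Vn_local_UC_same s (size_iota k n) (iota_uniq k n) hpq); rewrite mem_iota; lia.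
Qed.

(** * Exchanging two heads of opposite signs *)

Ltac labels_solve :=
  let c := fresh "c" in
  move=> c; rewrite /fresh /ids /O /U /lid /= ?in_nil ?inE ?mem_iota; lia.

Lemma Vn_local_OC_rcons n t a : all lover t -> lover a ->
  Vn_local n [::] (rcons t a) [::] [::] (a :: t) [::] [::].
Proof.
elim: t => [|b t ih] /=; first by move=> _ _; exact: Vn_local_refl.
move=> /andP[hb ht] ha.
have := Vn_local_catl1 (ih ht ha) (u := [:: b]) (fresh_labels_nil _).
move=> /Vn_local_trans; apply.
have := Vn_local_catr (Vn_local_OC n (L := [::]) hb ha) (fresh_labels_nil [:: t; [::]; [::]]).
by rewrite !cats0.
Qed.

Section OppositeSigns.

Variables (n p q m : nat) (sp : bool).
Hypotheses (hpq : p != q) (hpm : p < m) (hqm : q < m).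

Local Notation sq := (~~ sp).
Local Notation x := m.
Local Notation x' := m.+1.
Local Notation y := m.+2.
Local Notation y' := m.+3.
Local Notation labels := [:: p, q, x, x', y, y' & iota m.+4 n].

(* R2 moves surround the tail of [p] by auxiliary crossings [x, x'] and
   [y, y']; R3 and OC moves then carry the tail of [q] across, so that the
   heads of [y] and [q], which have the same sign, become adjacent. *)
Lemma Vn_local_UC_opp_prepare :
  Vn_local n labels
    [:: O p sp] [:: O q sq] [:: U p sp; U q sq]
    [:: O x sp; O y sq; O y' sp; O p sp; O x' sq] [:: U x' sq; U x sp; O q sq]
      [:: U y' sp; U q sq; U y sq; U p sp].
Proof.
have s1 : Vn_local n labels
    [:: O p sp] [:: O q sq] [:: U p sp; U q sq]
    [:: O p sp; O x sp; O x' sq] [:: U x' sq; U x sp; O q sq] [:: U p sp; U q sq].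
  by apply: (Vn_local_in_context n [:: O p sp] [::] [::] [:: O q sq] [::] [:: U p sp; U q sq]
    (Vn_local_R2 n sp false (ltac:(lia) : x != x'))); labels_solve.
have s2 : Vn_local n labels
    [:: O p sp; O x sp; O x' sq] [:: U x' sq; U x sp; O q sq] [:: U p sp; U q sq]
    [:: O x sp; O p sp; O x' sq] [:: U x' sq; O q sq; U x sp] [:: U q sq; U p sp].
  have hu : uniq [:: x; p; q] by rewrite /= !inE; lia.
  by apply: (Vn_local_in_context n [::] [:: O x' sq] [:: U x' sq] [::] [::] [::]
    (Vn_local_R3_opp n (L := [::]) sp hu)); labels_solve.
have s3 : Vn_local n labels
    [:: O x sp; O p sp; O x' sq] [:: U x' sq; O q sq; U x sp] [:: U q sq; U p sp]
    [:: O y sq; O y' sp; O x sp; O p sp; O x' sq] [:: U x' sq; O q sq; U x sp]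
      [:: U y' sp; U y sq; U q sq; U p sp].
  have := Vn_local_swap23 (Vn_local_R2 n sq false (ltac:(lia) : y != y')); rewrite negbK => h.
  by apply: (Vn_local_in_context n [::] [:: O x sp; O p sp; O x' sq]
    [::] [:: U x' sq; O q sq; U x sp] [::] [:: U q sq; U p sp] h); labels_solve.
have s4 : Vn_local n labels
    [:: O y sq; O y' sp; O x sp; O p sp; O x' sq] [:: U x' sq; O q sq; U x sp]
      [:: U y' sp; U y sq; U q sq; U p sp]
    [:: O y sq; O x sp; O y' sp; O p sp; O x' sq] [:: U x' sq; O q sq; U x sp]
      [:: U y' sp; U y sq; U q sq; U p sp].
  by apply: (Vn_local_in_context n [:: O y sq] [:: O p sp; O x' sq]
    [::] [:: U x' sq; O q sq; U x sp] [::] [:: U y' sp; U y sq; U q sq; U p sp]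
    (Vn_local_OC n (L := [::]) (a := O y' sp) (b := O x sp) isT isT)); labels_solve.
have s5 : Vn_local n labels
    [:: O y sq; O x sp; O y' sp; O p sp; O x' sq] [:: U x' sq; O q sq; U x sp]
      [:: U y' sp; U y sq; U q sq; U p sp]
    [:: O x sp; O y sq; O y' sp; O p sp; O x' sq] [:: U x' sq; U x sp; O q sq]
      [:: U y' sp; U q sq; U y sq; U p sp].
  have hu : uniq [:: x; y; q] by rewrite /= !inE; lia.
  have := Vn_local_R3_slide n (L := [::]) sq hu; rewrite negbK => h.
  by apply: (Vn_local_in_context n [::] [:: O y' sp; O p sp; O x' sq]
    [:: U x' sq] [::] [:: U y' sp] [:: U p sp] h); labels_solve.
exact: Vn_local_trans s1 (Vn_local_trans s2 (Vn_local_trans s3 (Vn_local_trans s4 s5))).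
Qed.

Lemma Vn_local_UC_opp :
  Vn_local n labels [:: O p sp] [:: O q sq] [:: U p sp; U q sq]
                    [:: O p sp] [:: O q sq] [:: U q sq; U p sp].
Proof.
have s6 : Vn_local n labels
    [:: O x sp; O y sq; O y' sp; O p sp; O x' sq] [:: U x' sq; U x sp; O q sq]
      [:: U y' sp; U q sq; U y sq; U p sp]
    [:: O x sp; O x' sq; O y sq; O y' sp; O p sp] [:: U x' sq; U x sp; O q sq]
      [:: U y' sp; U q sq; U y sq; U p sp].
  have h := Vn_local_OC_rcons n (t := [:: O y sq; O y' sp; O p sp]) (a := O x' sq) isT isT.
  by apply: (Vn_local_in_context n [:: O x sp] [::] [::] [:: U x' sq; U x sp; O q sq]
    [::] [:: U y' sp; U q sq; U y sq; U p sp] h); labels_solve.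
have s7 : Vn_local n labels
    [:: O y sq; O y' sp; O p sp] [:: O q sq] [:: U y' sp; U q sq; U y sq; U p sp]
    [:: O x sp; O x' sq; O y sq; O y' sp; O p sp] [:: U x' sq; U x sp; O q sq]
      [:: U y' sp; U q sq; U y sq; U p sp].
  by apply: (Vn_local_in_context n [::] [:: O y sq; O y' sp; O p sp] [::] [:: O q sq]
    [::] [:: U y' sp; U q sq; U y sq; U p sp]
    (Vn_local_R2 n sp false (ltac:(lia) : x != x'))); labels_solve.
have s8 : Vn_local n labels
    [:: O y sq; O y' sp; O p sp] [:: O q sq] [:: U y' sp; U y sq; U q sq; U p sp]
    [:: O y sq; O y' sp; O p sp] [:: O q sq] [:: U y' sp; U q sq; U y sq; U p sp].
  by apply: (Vn_local_in_context n [::] [:: O y' sp; O p sp] [::] [::] [:: U y' sp] [:: U p sp]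
    (@Vn_local_UC_same_iota n y q m.+4 sq ltac:(lia) ltac:(lia) ltac:(lia))); labels_solve.
have s9 : Vn_local n labels
    [:: O p sp] [:: O q sq] [:: U q sq; U p sp]
    [:: O y sq; O y' sp; O p sp] [:: O q sq] [:: U y' sp; U y sq; U q sq; U p sp].
  have := Vn_local_swap23 (Vn_local_R2 n sq false (ltac:(lia) : y != y')); rewrite negbK => h.
  by apply: (Vn_local_in_context n [::] [:: O p sp] [::] [:: O q sq] [::] [:: U q sq; U p sp]
    h); labels_solve.
apply: Vn_local_trans Vn_local_UC_opp_prepare _.
exact: Vn_local_trans s6 (Vn_local_trans (Vn_local_sym s7)
  (Vn_local_trans (Vn_local_sym s8) (Vn_local_sym s9))).
Qed.

End OppositeSigns.

Lemma Vn_local_UC n p q m sp sq : p != q -> p < m -> q < m ->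
  Vn_local n [:: p, q, m, m.+1, m.+2, m.+3 & iota m.+4 n]
    [:: O p sp] [:: O q sq] [:: U p sp; U q sq] [:: O p sp] [:: O q sq] [:: U q sq; U p sp].
Proof.
move=> hpq hpm hqm; case: (eqVneq sq sp) => [->|hs]; last first.
  by move: hs; case: sp; case: sq => // _; exact: Vn_local_UC_opp.
apply: Vn_local_sub (@Vn_local_UC_same_iota n p q m.+4 sp hpq ltac:(lia) ltac:(lia)).
by move=> c; rewrite !inE; lia.
Qed.

(** * Exchanging a head with an adjacent tail *)

Section MixedExchange.

Variables (n x z m : nat) (s : bool).
Hypotheses (hxz : x != z) (hxm : x < m) (hzm : z < m).

Local Notation y := m.
Local Notation y' := m.+1.
Local Notation labels := [:: x, z, y, y' & iota m.+2 n].

Lemma Vn_local_mix_opp :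
  Vn_local n labels [:: O x s] [:: U x s; O z (~~ s)] [:: U z (~~ s)]
                    [:: O x s] [:: O z (~~ s); U x s] [:: U z (~~ s)].
Proof.
have hR2 := Vn_local_swap23 (Vn_local_R2 n s false (ltac:(lia) : y != y')).
have a1 : Vn_local n labels
    [:: O x s] [:: U x s; O z (~~ s)] [:: U z (~~ s)]
    [:: O y s; O y' (~~ s); O x s] [:: U x s; O z (~~ s)] [:: U y' (~~ s); U y s; U z (~~ s)].
  by apply: (Vn_local_in_context n [::] [:: O x s] [::] [:: U x s; O z (~~ s)]
    [::] [:: U z (~~ s)] hR2); labels_solve.
have a2 : Vn_local n labels
    [:: O y s; O y' (~~ s); O x s] [:: U x s; O z (~~ s)] [:: U y' (~~ s); U y s; U z (~~ s)]
    [:: O y s; O x s; O y' (~~ s)] [:: U x s; O z (~~ s)] [:: U y' (~~ s); U y s; U z (~~ s)].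
  by apply: (Vn_local_in_context n [:: O y s] [::] [::] [:: U x s; O z (~~ s)]
    [::] [:: U y' (~~ s); U y s; U z (~~ s)]
    (Vn_local_OC n (L := [::]) (a := O y' (~~ s)) (b := O x s) isT isT)); labels_solve.
have a3 : Vn_local n labels
    [:: O y s; O x s; O y' (~~ s)] [:: U x s; O z (~~ s)] [:: U y' (~~ s); U y s; U z (~~ s)]
    [:: O x s; O y s; O y' (~~ s)] [:: O z (~~ s); U x s] [:: U y' (~~ s); U z (~~ s); U y s].
  have hu : uniq [:: x; y; z] by rewrite /= !inE; lia.
  by apply: (Vn_local_in_context n [::] [:: O y' (~~ s)] [::] [::] [:: U y' (~~ s)] [::]
    (Vn_local_R3_opp n (L := [::]) s hu)); labels_solve.
have a4 : Vn_local n labels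
    [:: O x s; O y s; O y' (~~ s)] [:: O z (~~ s); U x s] [:: U y' (~~ s); U z (~~ s); U y s]
    [:: O x s; O y s; O y' (~~ s)] [:: O z (~~ s); U x s] [:: U z (~~ s); U y' (~~ s); U y s].
  by apply: (Vn_local_in_context n [:: O x s; O y s] [::] [::] [:: U x s] [::] [:: U y s]
    (@Vn_local_UC_same_iota n y' z m.+2 (~~ s) ltac:(lia) ltac:(lia) ltac:(lia))); labels_solve.
have a5 : Vn_local n labels
    [:: O x s] [:: O z (~~ s); U x s] [:: U z (~~ s)]
    [:: O x s; O y s; O y' (~~ s)] [:: O z (~~ s); U x s] [:: U z (~~ s); U y' (~~ s); U y s].
  by apply: (Vn_local_in_context n [:: O x s] [::] [::] [:: O z (~~ s); U x s]
    [:: U z (~~ s)] [::] hR2); labels_solve.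
exact: Vn_local_trans a1 (Vn_local_trans a2 (Vn_local_trans a3
  (Vn_local_trans a4 (Vn_local_sym a5)))).
Qed.

Lemma Vn_local_mix_same :
  Vn_local n labels [:: O x s] [:: U x s; O z s] [:: U z s]
                    [:: O x s] [:: O z s; U x s] [:: U z s].
Proof.
have := Vn_local_swap23 (Vn_local_R2 n (~~ s) true (ltac:(lia) : y != y')).
rewrite negbK => hR2.
have b1 : Vn_local n labels
    [:: O x s] [:: U x s; O z s] [:: U z s]
    [:: O y (~~ s); O y' s; O x s] [:: U x s; O z s] [:: U z s; U y (~~ s); U y' s].
  by apply: (Vn_local_in_context n [::] [:: O x s] [::] [:: U x s; O z s] [:: U z s] [::]
    hR2); labels_solve.
have b2 : Vn_local n labels
    [:: O y (~~ s); O y' s; O x s] [:: U x s; O z s] [:: U z s; U y (~~ s); U y' s]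
    [:: O y (~~ s); O x s; O y' s] [:: U x s; O z s] [:: U z s; U y (~~ s); U y' s].
  by apply: (Vn_local_in_context n [:: O y (~~ s)] [::] [::] [:: U x s; O z s]
    [::] [:: U z s; U y (~~ s); U y' s]
    (Vn_local_OC n (L := [::]) (a := O y' s) (b := O x s) isT isT)); labels_solve.
have b3 : Vn_local n labels
    [:: O y (~~ s); O x s; O y' s] [:: U x s; O z s] [:: U z s; U y (~~ s); U y' s]
    [:: O x s; O y (~~ s); O y' s] [:: O z s; U x s] [:: U y (~~ s); U z s; U y' s].
  have hu : uniq [:: x; y; z] by rewrite /= !inE; lia.
  by apply: (Vn_local_in_context n [::] [:: O y' s] [::] [::] [::] [:: U y' s]
    (Vn_local_R3_mix n (L := [::]) s hu)); labels_solve.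
have b4 : Vn_local n labels
    [:: O x s; O y (~~ s); O y' s] [:: O z s; U x s] [:: U y (~~ s); U y' s; U z s]
    [:: O x s; O y (~~ s); O y' s] [:: O z s; U x s] [:: U y (~~ s); U z s; U y' s].
  by apply: (Vn_local_in_context n [:: O x s; O y (~~ s)] [::] [::] [:: U x s]
    [:: U y (~~ s)] [::]
    (@Vn_local_UC_same_iota n y' z m.+2 s ltac:(lia) ltac:(lia) ltac:(lia))); labels_solve.
have b5 : Vn_local n labels
    [:: O x s] [:: O z s; U x s] [:: U z s]
    [:: O x s; O y (~~ s); O y' s] [:: O z s; U x s] [:: U y (~~ s); U y' s; U z s].
  by apply: (Vn_local_in_context n [:: O x s] [::] [::] [:: O z s; U x s] [::] [:: U z s]
    hR2); labels_solve.
exact: Vn_local_trans b1 (Vn_local_trans b2 (Vn_local_trans b3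
  (Vn_local_trans (Vn_local_sym b4) (Vn_local_sym b5)))).
Qed.

End MixedExchange.

Lemma Vn_local_mix n x z m sx sz : x != z -> x < m -> z < m ->
  Vn_local n [:: x, z, m, m.+1 & iota m.+2 n] [:: O x sx] [:: U x sx; O z sz] [:: U z sz]
                                              [:: O x sx] [:: O z sz; U x sx] [:: U z sz].
Proof.
move=> hxz hxm hzm; case: (eqVneq sz sx) => [->|hs]; first exact: Vn_local_mix_same.
by move: hs; case: sx; case: sz => // _; exact: Vn_local_mix_opp.
Qed.

(** * Exchanging adjacent endpoints in a diagram *)

Definition partner (l : letter) : letter := (lid l, ~~ lover l, lsign l).

Lemma Vn_local_exchange n (a b : letter) m : lid a != lid b -> lid a < m -> lid b < m ->
  Vn_local n [:: lid a, lid b, m, m.+1, m.+2, m.+3 & iota m.+4 n]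
    [:: partner a] [:: partner b] [:: a; b] [:: partner a] [:: partner b] [:: b; a].
Proof.
case: a b => [[p oa] sa] [[q ob] sb]; rewrite /partner /lid /lover /lsign /= => hpq hpm hqm.
have sub2 (c d : nat) : {subset [:: c, d, m, m.+1 & iota m.+2 n] <=
    [:: c, d, m, m.+1, m.+2, m.+3 & iota m.+4 n]}.
  by move=> i; rewrite !inE !mem_iota; lia.
have sub2C (c d : nat) : {subset [:: c, d, m, m.+1 & iota m.+2 n] <=
    [:: d, c, m, m.+1, m.+2, m.+3 & iota m.+4 n]}.
  by move=> i; rewrite !inE !mem_iota; lia.
case: oa; case: ob => /=.
- have h := Vn_local_swap23 (Vn_local_swap12 (Vn_local_OC n (L := [::])
    (a := (p, true, sa)) (b := (q, true, sb)) isT isT)).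
  apply: (Vn_local_in_context n [:: (p, false, sa)] [::] [:: (q, false, sb)] [::] [::] [::]
    h) => //.
- have hqp : q != p by rewrite eq_sym.
  have h := Vn_local_mix (n := n) sb sa hqp hqm hpm.
  exact: Vn_local_sub (sub2C q p) (Vn_local_swap12 (Vn_local_swap23 (Vn_local_sym h))).
- have h := Vn_local_mix (n := n) sa sb hpq hpm hqm.
  exact: Vn_local_sub (sub2 p q) (Vn_local_swap23 h).
- exact: (Vn_local_UC (n := n) sa sb hpq hpm hqm).
Qed.

Lemma split_word (x : letter) (w : seq letter) : x \in w -> exists w1 w2, w = w1 ++ x :: w2.
Proof. by case/splitPr => w1 w2; exists w1, w2. Qed.

Lemma split_diag (x : letter) (D : gauss) : x \in flatten D ->
  exists D1 w1 w2 D2, D = D1 ++ (w1 ++ x :: w2) :: D2.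
Proof.
case/flattenP => w /splitPr[D1 D2] /split_word[w1 [w2 ->]].
by exists D1, w1, w2, D2.
Qed.

Lemma place3_locate_in_word (w : seq letter) (R : gauss) (x1 x2 : letter) :
  x1 \in w -> x2 \in w ++ flatten R -> x1 != x2 ->
  exists sg W1 W2 W3 R', forall s, iso ((s ++ w) :: R) (place3 sg [:: x1] [:: x2] s W1 W2 W3 R').
Proof.
move=> /split_word[w1 [w2 ->]] + hne; rewrite mem_cat => /orP[|h2].
  rewrite mem_cat inE eq_sym (negbTE hne) /= => /orP[] /split_word[y1 [y2 ->]].
  - exists 1, w2, y2, y1, R => s; rewrite /place3 /=.
    by iso_solve [:: s; y1; [:: x2]; y2; [:: x1]; w2] R.
  - exists 0, y1, y2, w1, R => s; rewrite /place3 /=.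
    by iso_solve [:: s; w1; [:: x1]; y1; [:: x2]; y2] R.
case/split_diag: h2 => R1 [y1 [y2 [R2 ->]]].
exists 3, w2, (y2 ++ y1), w1, (R1 ++ R2) => s.
apply: iso_trans (iso_cons _ (iso_front _ _ _)) _; rewrite /place3 /=.
by iso_solve [:: s; w1; [:: x1]; w2; y1; [:: x2]; y2] (R1 ++ R2).
Qed.

Lemma place3_locate_in_circles (w : seq letter) (R : gauss) (x1 x2 : letter) :
  x1 \in flatten R -> x2 \in w ++ flatten R -> x1 != x2 ->
  exists sg W1 W2 W3 R', forall s, iso ((s ++ w) :: R) (place3 sg [:: x1] [:: x2] s W1 W2 W3 R').
Proof.
move=> /split_diag[R1 [z1 [z2 [R2 ->]]]] + hne.
suff : [|| x2 \in w, x2 \in z1, x2 \in z2 | x2 \in flatten (R1 ++ R2)] ->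
    exists sg W1 W2 W3 R', forall s,
      iso ((s ++ w) :: (z1 ++ x1 :: z2) :: R1 ++ R2) (place3 sg [:: x1] [:: x2] s W1 W2 W3 R').
  move=> hx2 hmem.
  have /hx2[sg [W1 [W2 [W3 [R' h]]]]] :
      [|| x2 \in w, x2 \in z1, x2 \in z2 | x2 \in flatten (R1 ++ R2)].
    move: hmem; rewrite !flatten_cat /= !mem_cat inE eq_sym (negbTE hne) /=.
    by repeat match goal with |- context [?y \in ?a] => case: (y \in a) end.
  by exists sg, W1, W2, W3, R' => s; apply: iso_trans (iso_cons _ (iso_front _ _ _)) (h s).
case/or4P=> [/split_word[y1 [y2 ->]]|/split_word[y1 [y2 ->]]|/split_word[y1 [y2 ->]]|].
- exists 4, (z2 ++ z1), y2, y1, (R1 ++ R2) => s; rewrite /place3 /=.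
  by iso_solve [:: s; y1; [:: x2]; y2; z1; [:: x1]; z2] (R1 ++ R2).
- exists 2, (z2 ++ y1), y2, w, (R1 ++ R2) => s; rewrite /place3 /=.
  by iso_solve [:: s; w; y1; [:: x2]; y2; [:: x1]; z2] (R1 ++ R2).
- exists 2, y1, (y2 ++ z1), w, (R1 ++ R2) => s; rewrite /place3 /=.
  by iso_solve [:: s; w; z1; [:: x1]; y1; [:: x2]; y2] (R1 ++ R2).
case/split_diag=> Q1 [t1 [t2 [Q2 ->]]].
exists 5, (z2 ++ z1), (t2 ++ t1), w, (Q1 ++ Q2) => s.
apply: iso_trans (iso_cons _ (iso_cons _ (iso_front _ _ _))) _; rewrite /place3 /=.
by iso_solve [:: s; w; z1; [:: x1]; z2; t1; [:: x2]; t2] (Q1 ++ Q2).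
Qed.

Lemma place3_locate (w : seq letter) (R : gauss) (x1 x2 : letter) :
  x1 \in w ++ flatten R -> x2 \in w ++ flatten R -> x1 != x2 ->
  exists sg W1 W2 W3 R', forall s, iso ((s ++ w) :: R) (place3 sg [:: x1] [:: x2] s W1 W2 W3 R').
Proof.
by rewrite mem_cat => /orP[]; [exact: place3_locate_in_word | exact: place3_locate_in_circles].
Qed.

Lemma mem_ids D l : l \in flatten D -> lid l \in ids D.
Proof. exact: map_f. Qed.

Lemma partner_mem D l : wf_gauss D -> l \in flatten D -> partner l \in flatten D.
Proof.
move=> wf hl; have [h1 h2 hs] := wf _ (mem_ids hl).
have [x hx /andP[/eqP ex hox]] : exists2 x, x \in flatten D &
    (lid x == lid l) && (lover x == ~~ lover l).
  apply/hasP; case: (lover l) in h1 h2 *; rewrite has_count.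
  - rewrite (eq_count (a2 := fun x => (lid x == lid l) && ~~ lover x)) ?h2 //.
    by move=> x; case: (lover x).
  - rewrite (eq_count (a2 := fun x => (lid x == lid l) && lover x)) ?h1 //.
    by move=> x; case: (lover x).
by rewrite /partner -ex -(eqP hox) -(hs x l) // -letter_eta.
Qed.

Lemma count_label_wf D c : wf_gauss D -> c \in ids D ->
  count (fun l => lid l == c) (flatten D) = 2.
Proof.
move=> wf hc; have [h1 h2 _] := wf c hc.
rewrite -size_filter -(count_predC lover) !count_filter -[2]/(1 + 1) -{1}h1 -h2.
by congr (_ + _); apply: eq_count => l /=; rewrite andbC.
Qed.

Section Fresh.

Variables (D D' : gauss) (X : seq letter).
Hypothesis hperm : perm_eq (flatten D) (X ++ flatten D').

Lemma fresh_of_count c : wf_gauss D -> c \in ids D ->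
  count (fun l => lid l == c) X = 2 -> fresh c D'.
Proof.
move=> wf hc hX; have := count_label_wf wf hc.
rewrite (permP hperm) count_cat hX -{2}[2]addn0 => /addnI h0.
apply/mapP => -[l hl el]; have : 0 < count (fun l => lid l == c) (flatten D').
  by rewrite -has_count; apply/hasP; exists l; rewrite // el.
by rewrite h0.
Qed.

Lemma fresh_of_gt c : \max_(i <- ids D) i < c -> fresh c D'.
Proof.
move=> hc; apply/negP => hD'.
have hcD : c \in ids D by rewrite /ids (perm_mem (perm_map lid hperm)) map_cat mem_cat hD' orbT.
by have := @leq_bigmax_seq _ (ids D) predT id c hcD isT; rewrite leqNgt hc.
Qed.

End Fresh.

Lemma partner_neq l : partner l != l.
Proof. by rewrite {2}[l]letter_eta; apply/eqP => -[]; case: (lover l). Qed.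

Lemma Vn_equiv_swap_adjacent n a b w R :
  wf_gauss ((a :: b :: w) :: R) -> lid a != lid b ->
  Vn_equiv n ((a :: b :: w) :: R) ((b :: a :: w) :: R).
Proof.
set D := (a :: b :: w) :: R => wf hab.
have haD : a \in flatten D by rewrite /= inE eqxx.
have hbD : b \in flatten D by rewrite /= !inE eqxx orbT.
have neq_lid l l' : lid l != lid l' -> (partner l == l') = false.
  by move=> hl; apply: contraNF hl => /eqP<-.
have ha' : partner a \in w ++ flatten R.
  by move: (partner_mem wf haD); rewrite /= !inE (negbTE (partner_neq a)) neq_lid.
have hb' : partner b \in w ++ flatten R.
  by move: (partner_mem wf hbD); rewrite /= !inE (negbTE (partner_neq b)) neq_lid // eq_sym.
have hab' : partner a != partner b by apply: contra_neq hab => /(congr1 lid).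
have [sg [W1 [W2 [W3 [R' hiso]]]]] := place3_locate ha' hb' hab'.
set m := (\max_(i <- ids D) i).+1.
have hm l : l \in flatten D -> lid l < m.
  by move=> hl; rewrite ltnS (@leq_bigmax_seq _ _ predT id) ?mem_ids.
have hperm : perm_eq (flatten D)
    ([:: partner a; partner b; a; b] ++ flatten [:: W1, W2, W3 & R']).
  exact: perm_trans (perm_flatten_iso (hiso [:: a; b])) (perm_flatten_place3 _ _ _ _ _ _ _ _).
have hba : (lid b == lid a) = false by rewrite eq_sym (negbTE hab).
have two_a : count (fun l => lid l == lid a) [:: partner a; partner b; a; b] = 2.
  by rewrite /= eqxx hba.
have two_b : count (fun l => lid l == lid b) [:: partner a; partner b; a; b] = 2.
  by rewrite /= eqxx (negbTE hab).
have hf : fresh_labels [:: lid a, lid b, m, m.+1, m.+2, m.+3 & iota m.+4 n] [:: W1, W2, W3 & R'].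
  move=> c; rewrite inE => /orP[/eqP->|].
    exact: (fresh_of_count hperm wf (mem_ids haD) two_a).
  rewrite inE => /orP[/eqP->|hc]; first exact: (fresh_of_count hperm wf (mem_ids hbD) two_b).
  by apply: (fresh_of_gt hperm); move: hc; rewrite !inE mem_iota -ltnS; lia.
exact: (Vn_equiv_iso (hiso _) (hiso _)
  (Vn_local_exchange (n := n) hab (hm _ haD) (hm _ hbD) sg hf)).
Qed.

(** * UC moves and unknotting *)

Lemma UC_step_Vn_equiv n D D' : wf_gauss D -> UC_step D D' -> Vn_equiv n D D'.
Proof.
move=> wf [a [b [w [R [ha hb eD eD']]]]]; subst D D'; apply: (Vn_equiv_swap_adjacent n wf).
have haD : a \in flatten ((a :: b :: w) :: R) by rewrite /= inE eqxx.
apply/eqP => eab; have [_ + _] := wf (lid a) (mem_ids haD).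
by rewrite /= eqxx ha -eab eqxx hb.
Qed.

Lemma wf_gauss_perm D D' : perm_eq (flatten D) (flatten D') -> wf_gauss D -> wf_gauss D'.
Proof.
move=> hp wf c hc; have [|h1 h2 hs] := wf c; first by rewrite /ids (perm_mem (perm_map lid hp)).
split; rewrite -?(permP hp) //.
by move=> l1 l2; rewrite -!(perm_mem hp); exact: hs.
Qed.

Lemma wf_gauss_remove D D' l : wf_gauss D ->
  perm_eq (flatten D) ([:: l; partner l] ++ flatten D') -> wf_gauss D'.
Proof.
move=> wf hp c hc.
have hcD : c \in ids D by rewrite /ids (perm_mem (perm_map lid hp)) map_cat mem_cat hc orbT.
have hcl : (lid l == c) = false.
  apply/negbTE; apply: contraTneq hc => hlc; rewrite -hlc in hcD *.
  by apply: (fresh_of_count hp wf hcD); rewrite /= eqxx.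
have [h1 h2 hs] := wf c hcD; split.
- by move: h1; rewrite (permP hp) count_cat /= hcl.
- by move: h2; rewrite (permP hp) count_cat /= hcl.
- by move=> l1 l2 hl1 hl2; apply: hs; rewrite (perm_mem hp) mem_cat ?hl1 ?hl2 orbT.
Qed.

Lemma Vn_equiv_swap_in_word n x a b y : wf_gauss [:: x ++ a :: b :: y] -> lid a != lid b ->
  Vn_equiv n [:: x ++ a :: b :: y] [:: x ++ b :: a :: y].
Proof.
have hrot z : iso [:: x ++ z] [:: z ++ x].
  by have := iso_rot (x ++ z) [::] (size x); rewrite rot_size_cat.
move=> wf hab; have wf' : wf_gauss [:: a :: b :: y ++ x].
  exact: wf_gauss_perm (perm_flatten_iso (hrot (a :: b :: y))) wf.
have := Vn_equiv_swap_adjacent n wf' hab.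
exact: Vn_equiv_iso (hrot (a :: b :: y)) (hrot (b :: a :: y)).
Qed.

Lemma Vn_equiv_bring n x u b v : wf_gauss [:: x ++ u ++ b :: v] -> lid b \notin map lid u ->
  Vn_equiv n [:: x ++ u ++ b :: v] [:: x ++ b :: u ++ v].
Proof.
elim/last_ind: u v => [|u a ih] v wf; first by move=> _; exact: Vn_equiv_refl.
rewrite map_rcons mem_rcons inE negb_or => /andP[hab hu].
move: wf; rewrite cat_rcons catA => wf.
have hba : lid a != lid b by rewrite eq_sym.
apply: Vn_equiv_trans (Vn_equiv_swap_in_word n wf hba) _.
rewrite -catA cat_rcons; apply: (ih (a :: v)) hu.
by apply: wf_gauss_perm wf; rewrite /= !cats0 -!catA !perm_cat2l perm_swap2.
Qed.

Lemma Vn_equiv_unknot n w : wf_gauss [:: w] -> Vn_equiv n [:: w] unknot.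
Proof.
have [k] := ubnP (size w); elim: k w => // k ih [|l w] hsize wf; first exact: Vn_equiv_refl.
have hl : l \in flatten [:: l :: w] by rewrite /= inE eqxx.
have : partner l \in w.
  by move: (partner_mem wf hl); rewrite /= cats0 inE (negbTE (partner_neq l)).
case/split_word=> u [v ew]; subst w.
have hperm : perm_eq (flatten [:: l :: u ++ partner l :: v])
                     ([:: l; partner l] ++ flatten [:: u ++ v]).
  by rewrite /= !cats0 perm_cons -cat1s perm_catCA.
have hfresh : fresh (lid l) [:: u ++ v].
  by apply: (fresh_of_count hperm wf (mem_ids hl)); rewrite /= eqxx.
have hu : lid (partner l) \notin map lid u.
  by apply: contra hfresh; rewrite /fresh /ids /= cats0 map_cat mem_cat => ->.
apply: Vn_equiv_trans (Vn_equiv_bring n (x := [:: l]) wf hu) _.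
have := welded_Vn_equiv n (@ws_R1 (u ++ v) [::] (lid l) (lover l) (lsign l) hfresh).
rewrite -letter_eta => /Vn_equiv_sym /Vn_equiv_trans; apply.
apply: ih; last exact: wf_gauss_remove wf hperm.
by move: hsize; rewrite /= !size_cat /= addnS !ltnS => /(leq_trans (leqnSn _)).
Qed.

Theorem proposition3p4 (n : nat) : 0 < n ->
  (forall D D' : gauss, wf_gauss D -> UC_step D D' -> Vn_equiv n D D') /\
  (forall D : gauss, wf_gauss D -> size D = 1 -> Vn_equiv n D unknot).
Proof.
move=> _; split; first exact: UC_step_Vn_equiv.
by move=> [|w [|]] // wf _; exact: Vn_equiv_unknot.
Qed.
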